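(* Assume $p>0$. With upper limit $u$, not necessarily $1$, $$\int_0^u \cos (px)\,\cosh\!\left(q\sqrt{u^2-x^2}\right)\frac{dx}{\sqrt{u^2-x^2}}=\frac{\pi}{2}\,J_0\!\left(\sqrt{p^2-q^2}\,u\right).$$
   Context: $J_0$ is the Bessel function of the first kind of order zero.
   Formalization: The upper limit u is taken to be real and positive, which the statement leaves unsaid: for u < 0 the left side is the negative of the right side (e.g. p=1, q=0, u=-1), and for u = 0 the right side is π/2 while the integral is 0. *)

(* Defs.v *)
From Stdlib Require Import Reals Lra Factorial.
From Coquelicot Require Import Coquelicot.
Open Scope R_scope.

Definition Cexp (z : C) : C :=
  (exp (Re z) * cos (Im z), exp (Re z) * sin (Im z)).

Definition Ccosh (z : C) : C := ((Cexp z + Cexp (- z)) / 2)%C.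

(* Principal branch: Re (Csqrt z) >= 0, and Csqrt (- r) = i sqrt r for r >= 0.
   On nonnegative reals it agrees with sqrt. *)
Definition Csqrt (z : C) : C :=
  (sqrt ((Cmod z + Re z) / 2),
   if Rle_dec 0 (Im z) then sqrt ((Cmod z - Re z) / 2)
   else - sqrt ((Cmod z - Re z) / 2)).

Definition J0_term (z : C) (k : nat) : C :=
  ((- (1)) ^ k / (INR (fact k) * INR (fact k)) * (z / 2) ^ (2 * k))%C.

(* J_0 as an entire function: the sum over k of (-1)^k / (k!)^2 * (z/2)^(2k).
   Series is real-valued, so the sum is taken componentwise; J0_is_series
   shows that this is the sum of the complex series. *)
Definition J0 (z : C) : C :=
  (Series (fun k => Re (J0_term z k)), Series (fun k => Im (J0_term z k))).

Lemma Ccosh_RtoC (x : R) : Ccosh (RtoC x) = RtoC (cosh x).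
Proof.
unfold Ccosh; rewrite <- RtoC_opp; unfold Cexp.
rewrite !re_RtoC, !im_RtoC, cos_0, sin_0, !Rmult_1_r, !Rmult_0_r.
change (exp x, 0) with (RtoC (exp x)).
change (exp (- x), 0) with (RtoC (exp (- x))).
now rewrite <- RtoC_plus, <- RtoC_div by lra.
Qed.

Lemma Csqrt_sqr (z : C) : (Csqrt z * Csqrt z)%C = z.
Proof.
assert (Hm := Cmod_ge_0 z).
assert (H2 := Cmod2_alt z).
assert (Hr := re_le_Cmod z).
destruct z as [a b].
unfold Csqrt, Cmult; simpl fst; simpl snd.
set (m := Cmod (a, b)) in *.
change (Re (a, b)) with a in *; change (Im (a, b)) with b in *.
apply Rabs_le_between in Hr.
assert (Hp : sqrt ((m + a) / 2) * sqrt ((m + a) / 2) = (m + a) / 2)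
  by (apply sqrt_sqrt; lra).
assert (Hn : sqrt ((m - a) / 2) * sqrt ((m - a) / 2) = (m - a) / 2)
  by (apply sqrt_sqrt; lra).
assert (Hx : sqrt ((m + a) / 2) * sqrt ((m - a) / 2) = Rabs b / 2).
{ rewrite <- sqrt_mult by lra.
  replace ((m + a) / 2 * ((m - a) / 2)) with (Rsqr (b / 2)).
  - rewrite sqrt_Rsqr_abs; unfold Rdiv; rewrite Rabs_mult.
    now rewrite (Rabs_pos_eq (/ 2)) by lra.
  - unfold Rsqr; simpl in H2; nra. }
destruct (Rle_dec 0 b) as [Hb | Hb].
- rewrite (Rabs_pos_eq b Hb) in Hx; f_equal; lra.
- rewrite (Rabs_left b) in Hx by lra; f_equal; lra.
Qed.

Lemma Cmod_J0_term (z : C) (k : nat) :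
  Cmod (J0_term z k) <= / INR (fact k) * (Cmod (z / 2) * Cmod (z / 2)) ^ k.
Proof.
assert (Hf := INR_fact_lt_0 k).
assert (Hf1 : 1 <= INR (fact k))
  by (apply (le_INR 1); apply lt_O_fact).
assert (Hc : RtoC (INR (fact k)) <> 0).
{ intros H; apply RtoC_inj in H; lra. }
unfold J0_term.
rewrite Cmod_mult, Cmod_div by (now apply Cmult_neq_0).
rewrite !Cmod_pow, Cmod_mult, !Cmod_R, Cmod_opp, Cmod_1, pow1.
rewrite Rabs_pos_eq by lra.
rewrite pow_mult.
replace (Cmod (z / 2) ^ 2) with (Cmod (z / 2) * Cmod (z / 2)) by ring.
apply Rmult_le_compat_r.
- apply pow_le; apply Rle_0_sqr.
- unfold Rdiv; rewrite Rmult_1_l; apply Rinv_le_contravar; nra.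
Qed.

Lemma J0_is_series (z : C) :
  @is_series C_AbsRing C_NormedModule (J0_term z) (J0 z).
Proof.
assert (He : ex_series
  (fun k => / INR (fact k) * (Cmod (z / 2) * Cmod (z / 2)) ^ k)).
{ exists (exp (Cmod (z / 2) * Cmod (z / 2))).
  eapply is_series_ext; [ | apply is_exp_Reals ].
  intros k; simpl; rewrite pow_n_pow; apply Rmult_comm. }
assert (Hre : ex_series (fun k => Re (J0_term z k))).
{ apply (@ex_series_le R_AbsRing R_CompleteNormedModule) with (2 := He).
  intros k; eapply Rle_trans; [ apply re_le_Cmod | apply Cmod_J0_term ]. }
assert (Him : ex_series (fun k => Im (J0_term z k))).
{ apply (@ex_series_le R_AbsRing R_CompleteNormedModule) with (2 := He).
  intros k; eapply Rle_trans; [ | apply Cmod_J0_term ].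
  eapply Rle_trans; [ apply Rmax_r | apply Rmax_Cmod ]. }
apply Series_correct in Hre; apply Series_correct in Him.
assert (Hs : forall n, sum_n (G := C_AbelianMonoid) (J0_term z) n =
  (sum_n (fun k => Re (J0_term z k)) n, sum_n (fun k => Im (J0_term z k)) n)).
{ induction n as [ | n IH ].
  - rewrite !sum_O; now destruct (J0_term z 0).
  - rewrite !sum_Sn, IH; now destruct (J0_term z (S n)). }
apply filterlim_locally; intros eps.
assert (H1 := proj1 (filterlim_locally _ _) Hre eps).
assert (H2 := proj1 (filterlim_locally _ _) Him eps).
generalize (filter_and _ _ H1 H2); apply filter_imp.
intros n [Ha Hb].
change (ball (J0 z) eps (sum_n (G := C_AbelianMonoid) (J0_term z) n)).
rewrite Hs; now split.
Qed.

(* Main.v *)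
(* Put a = p u, c = q u and w(t) = c cos t + i a sin t.  After x = u sin t the
   integrand is the even part of cosh (w t).  Since w'' = - w, the quantity
   w^2 + w'^2 = c^2 - a^2 is constant, so differentiating w^(2n+1) w' gives a
   recurrence between the integrals of w^(2n) and w^(2n+2) over [0, PI/2]; its
   boundary terms cancel between w(t) and w(-t).  Hence the Taylor polynomials of
   cosh integrate to PI/2 times the partial sums of J0, and their uniform
   convergence along w gives the result. *)

Require Import Defs.
From Stdlib Require Import Reals Lra Lia Factorial.
From Coquelicot Require Import Coquelicot.
Open Scope R_scope.

(** As [q] is complex, w is a curve in the complex plane, and the calculus needed is that of
    functions from R to C. [Cexp] is built from real functions, not from a power series; its Taylor
    polynomials are reached by integrating along the ray s -> s z, on which each remainder is a
    primitive of z times the preceding one. On the quarter period [0, PI/2] the end values of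
    w^(2n+1) w' do not vanish in general for a single w. Reversing t changes their sign at both
    ends, so w(t) and w(-t) are integrated together and only the sum of their moments gets a closed
    form. The given integral is improper at u, while the integrand in the variable t is continuous.
    All approximation therefore takes place in t, and the limit at u is left to the substitution
    alone. *)

Local Notation is_Cderive := (@is_derive R_AbsRing C_R_NormedModule).
Local Notation is_CRInt := (@is_RInt C_R_NormedModule).

(** * Derivatives and integrals of complex functions of a real variable *)

Lemma Cdiv_1_r (z : C) : (z / 1)%C = z.
Proof. field; intros H; apply RtoC_inj in H; lra. Qed.

(** Integral estimates are phrased with the norm of the real module; this turns them into estimates
    on [Cmod]. *)
Lemma norm_Cmod (z : C) : @norm R_AbsRing C_R_NormedModule z = Cmod z.
Proof.
unfold norm; simpl; unfold prod_norm, Cmod; f_equal.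
unfold norm; simpl; unfold abs; simpl.
now rewrite !Rmult_1_r, <- !Rabs_mult, !Rabs_pos_eq by nra.
Qed.

(** The product of two complex functions is not the scalar action of the real module, so the product
    and exponential rules are proved in each component. The complex derivative is reassembled here
    by composing with the linear map (a, b) -> (a, b). *)
Lemma is_Cderive_pair (f : R -> C) (x : R) (l : C) :
  is_derive (fun t => fst (f t)) x (fst l) ->
  is_derive (fun t => snd (f t)) x (snd l) ->
  is_Cderive f x l.
Proof.
intros H1 H2.
apply (is_derive_ext (fun t => (fst (f t), snd (f t)) : C_R_NormedModule)).
{ intros t; now destruct (f t). }
unfold is_derive.
apply filterdiff_ext_lin with
  (fun y : R => (scal y (fst l), scal y (snd l)) : C_R_NormedModule).
2: { intros y; now destruct l. }
apply (filterdiff_comp'_2 (K := R_AbsRing) (T := R_NormedModule)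
  (U := R_NormedModule) (V := R_NormedModule) (W := C_R_NormedModule)
  (fun t => fst (f t)) (fun t => snd (f t)) (fun a b => (a, b)) x
  (fun y => scal y (fst l)) (fun y => scal y (snd l)) (fun a b => (a, b)));
  [ exact H1 | exact H2 | ].
apply filterdiff_ext_lin with (fun t : C_R_NormedModule => t).
2: { now intros [y1 y2]. }
apply (filterdiff_ext (fun t : C_R_NormedModule => t)); [ now intros [y1 y2] | ].
apply filterdiff_id.
Qed.

Lemma is_Cderive_fst (f : R -> C) (x : R) (l : C) :
  is_Cderive f x l -> is_derive (fun t => fst (f t)) x (fst l).
Proof.
intros H.
apply (filterdiff_comp' (K := R_AbsRing) (U := R_NormedModule)
  (V := C_R_NormedModule) (W := R_NormedModule) f (fun z => fst z) x
  (fun y => scal y l) (fun z => fst z)); [ exact H | ].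
apply filterdiff_linear, is_linear_fst.
Qed.

Lemma is_Cderive_snd (f : R -> C) (x : R) (l : C) :
  is_Cderive f x l -> is_derive (fun t => snd (f t)) x (snd l).
Proof.
intros H.
apply (filterdiff_comp' (K := R_AbsRing) (U := R_NormedModule)
  (V := C_R_NormedModule) (W := R_NormedModule) f (fun z => snd z) x
  (fun y => scal y l) (fun z => snd z)); [ exact H | ].
apply filterdiff_linear, is_linear_snd.
Qed.

Lemma is_Cderive_eq (f : R -> C) (x : R) (l l' : C) :
  is_Cderive f x l -> l = l' -> is_Cderive f x l'.
Proof. now intros H <-. Qed.

Lemma is_Cderive_RtoC (f : R -> R) (x l : R) :
  is_derive f x l -> is_Cderive (fun t => RtoC (f t)) x (RtoC l).
Proof.
intros H; apply is_Cderive_pair; simpl; [ exact H | ].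
apply (is_derive_const (V := R_NormedModule)).
Qed.

Lemma is_Cderive_const (z : C) (x : R) : is_Cderive (fun _ => z) x (RtoC 0).
Proof. apply (is_derive_const (V := C_R_NormedModule)). Qed.

Lemma is_Cderive_plus (f g : R -> C) (x : R) (lf lg : C) :
  is_Cderive f x lf -> is_Cderive g x lg ->
  is_Cderive (fun t => (f t + g t)%C) x (lf + lg)%C.
Proof. apply (is_derive_plus (V := C_R_NormedModule)). Qed.

Lemma is_derive_eq (f : R -> R) (x l l' : R) :
  is_derive f x l -> l = l' -> is_derive f x l'.
Proof. now intros H <-. Qed.

Lemma is_derive_Rmult (f g : R -> R) (x lf lg : R) :
  is_derive f x lf -> is_derive g x lg ->
  is_derive (fun t => f t * g t) x (lf * g x + f x * lg).
Proof.
intros Hf Hg; apply (is_derive_mult (K := R_AbsRing)); auto.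
intros; apply Rmult_comm.
Qed.

Lemma is_Cderive_mult (f g : R -> C) (x : R) (lf lg : C) :
  is_Cderive f x lf -> is_Cderive g x lg ->
  is_Cderive (fun t => (f t * g t)%C) x (lf * g x + f x * lg)%C.
Proof.
intros Hf Hg.
assert (F1 := is_Cderive_fst _ _ _ Hf); assert (F2 := is_Cderive_snd _ _ _ Hf).
assert (G1 := is_Cderive_fst _ _ _ Hg); assert (G2 := is_Cderive_snd _ _ _ Hg).
apply is_Cderive_pair; simpl.
- eapply is_derive_eq.
  + apply (is_derive_minus (V := R_NormedModule)); apply is_derive_Rmult; eauto.
  + unfold minus, plus, opp; simpl; ring.
- eapply is_derive_eq.
  + apply (is_derive_plus (V := R_NormedModule)); apply is_derive_Rmult; eauto.
  + unfold plus; simpl; ring.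
Qed.

Lemma is_Cderive_pow (f : R -> C) (x : R) (l : C) (n : nat) :
  is_Cderive f x l ->
  is_Cderive (fun t => (f t ^ S n)%C) x (RtoC (INR (S n)) * l * f x ^ n)%C.
Proof.
intros Hf; induction n as [ | n IH ].
- apply (is_derive_ext f); [ intros t; symmetry; apply Cmult_1_r | ].
  simpl; replace (1 * l * 1)%C with l by ring; exact Hf.
- apply (is_derive_ext (fun t => (f t * f t ^ S n)%C)); [ reflexivity | ].
  replace (RtoC (INR (S (S n))) * l * f x ^ S n)%C
    with (l * f x ^ S n + f x * (RtoC (INR (S n)) * l * f x ^ n))%C.
  2: { rewrite (S_INR (S n)), RtoC_plus, !Cpow_S; ring. }
  now apply is_Cderive_mult.
Qed.

Lemma is_Cderive_Cexp (f : R -> C) (x : R) (l : C) :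
  is_Cderive f x l -> is_Cderive (fun t => Cexp (f t)) x (l * Cexp (f x))%C.
Proof.
intros Hf.
assert (F1 := is_Cderive_fst _ _ _ Hf); assert (F2 := is_Cderive_snd _ _ _ Hf).
assert (He : is_derive (fun t => exp (fst (f t))) x (fst l * exp (fst (f x)))).
{ apply (is_derive_comp (V := R_NormedModule) exp); [ apply is_derive_exp | exact F1 ]. }
assert (Hc : is_derive (fun t => cos (snd (f t))) x (snd l * - sin (snd (f x)))).
{ apply (is_derive_comp (V := R_NormedModule) cos); [ apply is_derive_cos | exact F2 ]. }
assert (Hs : is_derive (fun t => sin (snd (f t))) x (snd l * cos (snd (f x)))).
{ apply (is_derive_comp (V := R_NormedModule) sin); [ apply is_derive_sin | exact F2 ]. }
apply is_Cderive_pair; unfold Cexp, Re, Im; simpl.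
- eapply is_derive_eq; [ exact (is_derive_Rmult _ _ _ _ _ He Hc) | cbv beta; ring ].
- eapply is_derive_eq; [ exact (is_derive_Rmult _ _ _ _ _ He Hs) | cbv beta; ring ].
Qed.

Lemma is_Cderive_continuous (f : R -> C) (x : R) (l : C) :
  is_Cderive f x l -> @continuous R_UniformSpace C_R_NormedModule f x.
Proof.
intros H; apply (ex_derive_continuous (V := C_R_NormedModule)); now exists l.
Qed.

(** Each component of z f is a fixed real combination of the two components of f. *)
Lemma is_CRInt_Cmult (z : C) (f : R -> C) (a b : R) (l : C) :
  is_CRInt f a b l -> is_CRInt (fun t => (z * f t)%C) a b (z * l)%C.
Proof.
intros H.
assert (H1 := is_RInt_fct_extend_fst f a b l H).
assert (H2 := is_RInt_fct_extend_snd f a b l H).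
apply (is_RInt_fct_extend_pair (U := R_NormedModule) (V := R_NormedModule)); simpl.
- apply (is_RInt_minus (V := R_NormedModule));
    now apply (is_RInt_scal (V := R_NormedModule)).
- apply (is_RInt_plus (V := R_NormedModule));
    now apply (is_RInt_scal (V := R_NormedModule)).
Qed.

(** * Taylor polynomials of exp and cosh with explicit remainders *)

Definition exp_partial (z : C) (n : nat) : C :=
  sum_n (G := C_AbelianMonoid) (fun k => (z ^ k / RtoC (INR (fact k)))%C) n.

Lemma INR_fact_C_neq_0 (k : nat) : RtoC (INR (fact k)) <> 0.
Proof. intros H; apply RtoC_inj in H; now apply (INR_fact_neq_0 k). Qed.

Lemma is_Cderive_ray (z : C) (x : R) : is_Cderive (fun t => (RtoC t * z)%C) x z.
Proof.
apply is_Cderive_eq with (RtoC 1 * z + RtoC x * RtoC 0)%C; [ | ring ].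
apply (is_Cderive_mult (fun t => RtoC t) (fun _ => z)).
- apply (is_Cderive_RtoC (fun t => t)), (is_derive_id (K := R_AbsRing)).
- apply is_Cderive_const.
Qed.

(** The derivative of (s z)^(k+1) / (k+1)! in s is z (s z)^k / k!, so differentiation shifts the sum
    by one degree and kills the constant term. *)
Lemma is_Cderive_exp_partial (z : C) (n : nat) (x : R) :
  is_Cderive (fun t => exp_partial (RtoC t * z)%C (S n)) x
    (z * exp_partial (RtoC x * z)%C n)%C.
Proof.
assert (Hk : forall k, is_Cderive
  (fun t => ((RtoC t * z) ^ S k / RtoC (INR (fact (S k))))%C) x
  (z * ((RtoC x * z) ^ k / RtoC (INR (fact k))))%C).
{ intros k.
  replace (z * ((RtoC x * z) ^ k / RtoC (INR (fact k))))%C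
    with (RtoC (INR (S k)) * z * (RtoC x * z) ^ k * / RtoC (INR (fact (S k)))
          + (RtoC x * z) ^ S k * RtoC 0)%C.
  - apply (is_Cderive_mult (fun t => ((RtoC t * z) ^ S k)%C)
      (fun _ => (/ RtoC (INR (fact (S k))))%C)).
    + apply (is_Cderive_pow (fun t => (RtoC t * z)%C)), is_Cderive_ray.
    + apply is_Cderive_const.
  - rewrite fact_simpl, mult_INR, RtoC_mult; field.
    split; [ apply INR_fact_C_neq_0 | ].
    intros H; apply RtoC_inj in H; now apply (not_0_INR (S k)). }
unfold exp_partial; induction n as [ | n IH ].
- apply (is_derive_ext (fun t => (RtoC 1 + ((RtoC t * z) ^ 1 / RtoC (INR (fact 1))))%C)).
  { intros t; rewrite sum_Sn, sum_O; change (@plus C_AbelianMonoid) with Cplus.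
    f_equal; symmetry; exact (Cdiv_1_r _). }
  rewrite sum_O.
  rewrite <- (Cplus_0_l (z * _)).
  apply is_Cderive_plus; [ apply is_Cderive_const | apply Hk ].
- apply (is_derive_ext (fun t =>
    (sum_n (G := C_AbelianMonoid)
       (fun k => ((RtoC t * z) ^ k / RtoC (INR (fact k)))%C) (S n)
     + (RtoC t * z) ^ S (S n) / RtoC (INR (fact (S (S n)))))%C)).
  { intros t; now rewrite (sum_Sn _ (S n)). }
  rewrite (sum_Sn (G := C_AbelianMonoid) _ n).
  change (@plus C_AbelianMonoid) with Cplus.
  rewrite Cmult_plus_distr_l.
  apply is_Cderive_plus; [ exact IH | apply Hk ].
Qed.

Lemma is_Cderive_minus (f g : R -> C) (x : R) (lf lg : C) :
  is_Cderive f x lf -> is_Cderive g x lg ->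
  is_Cderive (fun t => (f t - g t)%C) x (lf - lg)%C.
Proof. apply (is_derive_minus (V := C_R_NormedModule)). Qed.

Lemma Cmod_Cexp (z : C) : Cmod (Cexp z) = exp (Re z).
Proof.
unfold Cexp, Cmod; simpl.
replace (_ + _) with (Rsqr (exp (Re z))).
- rewrite sqrt_Rsqr_abs; apply Rabs_pos_eq, Rlt_le, exp_pos.
- unfold Rsqr.
  assert (H := sin2_cos2 (Im z)); unfold Rsqr in H.
  transitivity (exp (Re z) * exp (Re z)
    * (sin (Im z) * sin (Im z) + cos (Im z) * cos (Im z)));
    [ rewrite H | ]; ring.
Qed.

(** The inductive step for Taylor remainders: since g vanishes at 0, it is the integral of its
    derivative, and s^n / n! integrates to t^(n+1) / (n+1)!. *)
Lemma Cmod_le_of_derive_le_pow (g dg : R -> C) (b t : R) (n : nat) :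
  0 <= t ->
  (forall s, is_Cderive g s (dg s)) ->
  (forall s, @continuous R_UniformSpace C_R_NormedModule dg s) ->
  g 0 = RtoC 0 ->
  (forall s, 0 <= s <= t -> Cmod (dg s) <= b * (s ^ n / INR (fact n))) ->
  Cmod (g t) <= b * (t ^ S n / INR (fact (S n))).
Proof.
intros Ht Hg Hc H0 Hb.
rewrite <- norm_Cmod.
apply (norm_RInt_le (V := C_R_NormedModule) dg
  (fun s => b * (s ^ n / INR (fact n))) 0 t).
- exact Ht.
- intros s Hs; rewrite norm_Cmod; now apply Hb.
- replace (g t) with (@minus C_R_NormedModule (g t) (g 0)).
  2: { rewrite H0; apply (minus_zero_r (G := C_R_NormedModule)). }
  apply (is_RInt_derive (V := C_R_CompleteNormedModule) g dg); auto.
- replace (b * (t ^ S n / INR (fact (S n)))) with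
    (minus (b * (t ^ S n / INR (fact (S n))))
       (b * (0 ^ S n / INR (fact (S n)))))
    by (unfold minus, plus, opp; simpl; unfold Rdiv; ring).
  apply (is_RInt_derive (V := R_CompleteNormedModule)
    (fun s => b * (s ^ S n / INR (fact (S n))))).
  + intros s _; auto_derive; [ trivial | ].
    change (INR (fact n + n * fact n)) with (INR (S n * fact n)).
    change (match n with 0%nat => 1 | S _ => INR n + 1 end) with (INR (S n)).
    rewrite mult_INR.
    field; split; [ apply INR_fact_neq_0 | now apply not_0_INR ].
  + intros s _.
    apply (ex_derive_continuous (V := R_NormedModule)); auto_derive; trivial.
Qed.

Lemma exp_partial_0 (n : nat) : exp_partial (RtoC 0) n = RtoC 1.
Proof.
unfold exp_partial; induction n as [ | n IH ].
- rewrite sum_O; apply Cdiv_1_r.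
- rewrite sum_Sn, IH; change (@plus C_AbelianMonoid) with Cplus.
  rewrite Cpow_S; unfold Cdiv; ring.
Qed.

(** Induction on n. Every remainder vanishes at t = 0 and its derivative along the ray is z times
    the remainder of one degree less; the induction starts from the bound exp (Cmod z) on exp over
    the segment from 0 to z. *)
Lemma Cexp_ray_remainder (z : C) (n : nat) (t : R) : 0 <= t <= 1 ->
  Cmod (Cexp (RtoC t * z) - exp_partial (RtoC t * z) n)
  <= exp (Cmod z) * Cmod z ^ S n * (t ^ S n / INR (fact (S n))).
Proof.
assert (Hz := Cmod_ge_0 z).
assert (Hexp : forall s, 0 <= s <= 1 -> Cmod (Cexp (RtoC s * z)) <= exp (Cmod z)).
{ intros s Hs; rewrite Cmod_Cexp.
  assert (Hr : Re (RtoC s * z) <= Cmod z).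
  { eapply Rle_trans; [ apply Rle_abs | ].
    eapply Rle_trans; [ apply re_le_Cmod | ].
    rewrite Cmod_mult, Cmod_R, Rabs_pos_eq by lra; nra. }
  destruct Hr as [Hr | Hr]; [ left; now apply exp_increasing | right; now rewrite Hr ]. }
assert (HE0 : Cexp (RtoC 0 * z) = RtoC 1).
{ rewrite Cmult_0_l; unfold Cexp; simpl; rewrite exp_0, cos_0, sin_0.
  now rewrite Rmult_1_r, Rmult_0_r. }
assert (HdE : forall s, is_Cderive (fun s => Cexp (RtoC s * z)) s
  (z * Cexp (RtoC s * z))%C).
{ intros s; apply (is_Cderive_Cexp (fun s => (RtoC s * z)%C)), is_Cderive_ray. }
(* This serves the continuity of the derivative of the remainder. Degree 0 is treated apart because
   the shift formula begins at degree 1. *)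
assert (HdP : forall m s, exists l,
  is_Cderive (fun s => exp_partial (RtoC s * z) m) s l).
{ intros [ | m] s; [ | eexists; apply is_Cderive_exp_partial ].
  exists (RtoC 0); apply (is_derive_ext (K := R_AbsRing) (V := C_R_NormedModule)
    (fun _ => exp_partial (RtoC 0) 0)).
  - intros r; unfold exp_partial; now rewrite !sum_O.
  - apply is_Cderive_const. }
revert t; induction n as [ | n IH ]; intros t Ht.
- rewrite pow_1; apply (Cmod_le_of_derive_le_pow
    (fun s => (Cexp (RtoC s * z) - exp_partial (RtoC s * z) 0)%C)
    (fun s => z * Cexp (RtoC s * z))%C); [ lra | | | | ].
  + intros s.
    replace (z * Cexp (RtoC s * z))%C with (z * Cexp (RtoC s * z) - RtoC 0)%C by ring.
    apply is_Cderive_minus; [ apply HdE | ].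
    apply (is_derive_ext (K := R_AbsRing) (V := C_R_NormedModule)
    (fun _ => exp_partial (RtoC 0) 0)).
    * intros r; unfold exp_partial; now rewrite !sum_O.
    * apply is_Cderive_const.
  + intros s; eapply is_Cderive_continuous.
    apply is_Cderive_mult; [ apply is_Cderive_const | apply HdE ].
  + rewrite HE0, Cmult_0_l, exp_partial_0; ring.
  + intros s Hs; simpl; rewrite Rdiv_1_r, Rmult_1_r, Cmod_mult, Rmult_comm.
    apply Rmult_le_compat_r; [ apply Cmod_ge_0 | apply Hexp; lra ].
- apply (Cmod_le_of_derive_le_pow
    (fun s => (Cexp (RtoC s * z) - exp_partial (RtoC s * z) (S n))%C)
    (fun s => z * (Cexp (RtoC s * z) - exp_partial (RtoC s * z) n))%C); [ lra | | | | ].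
  + intros s.
    replace (z * (Cexp (RtoC s * z) - exp_partial (RtoC s * z) n))%C
      with (z * Cexp (RtoC s * z) - z * exp_partial (RtoC s * z) n)%C by ring.
    apply is_Cderive_minus; [ apply HdE | apply is_Cderive_exp_partial ].
  + intros s; destruct (HdP n s) as [l Hl]; eapply is_Cderive_continuous.
    apply is_Cderive_mult; [ apply is_Cderive_const | ].
    apply is_Cderive_minus; [ apply HdE | exact Hl ].
  + rewrite HE0, Cmult_0_l, exp_partial_0; ring.
  + intros s Hs; rewrite Cmod_mult.
    replace (exp (Cmod z) * Cmod z ^ S (S n) * (s ^ S n / INR (fact (S n))))
      with (Cmod z * (exp (Cmod z) * Cmod z ^ S n * (s ^ S n / INR (fact (S n)))))
      by (change (Cmod z ^ S (S n)) with (Cmod z * Cmod z ^ S n); ring).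
    apply Rmult_le_compat_l; [ exact Hz | apply IH; lra ].
Qed.

Lemma exp_partial_S (z : C) (n : nat) :
  exp_partial z (S n) = (exp_partial z n + z ^ S n / RtoC (INR (fact (S n))))%C.
Proof. exact (sum_Sn (G := C_AbelianMonoid) _ n). Qed.

Definition cosh_partial (z : C) (n : nat) : C :=
  sum_n (G := C_AbelianMonoid) (fun k => (z ^ (2 * k) / RtoC (INR (fact (2 * k))))%C) n.

(** Odd powers cancel between z and - z, so both exponential sums may run up to the odd degree 2n+1.
    This makes 2n+2 the order of the remainder of cosh. *)
Lemma cosh_partial_exp (z : C) (n : nat) :
  cosh_partial z n
  = ((exp_partial z (S (2 * n)) + exp_partial (- z) (S (2 * n))) / RtoC 2)%C.
Proof.
assert (Hodd : forall k, ((- z) ^ S (2 * k) = - z ^ S (2 * k))%C).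
{ intros k; rewrite !Cpow_S, !Cpow_mult_r.
  replace ((- z) ^ 2)%C with (z ^ 2)%C by ring; ring. }
assert (Heven : forall k, ((- z) ^ (2 * k) = z ^ (2 * k))%C).
{ intros k; rewrite !Cpow_mult_r.
  now replace ((- z) ^ 2)%C with (z ^ 2)%C by ring. }
unfold cosh_partial; induction n as [ | n IH ].
- rewrite sum_O, !exp_partial_S; unfold exp_partial; rewrite !sum_O; simpl.
  field; intros H; apply RtoC_inj in H; lra.
- rewrite sum_Sn, IH; change (@plus C_AbelianMonoid) with Cplus.
  replace (2 * S n)%nat with (S (S (2 * n))) at 3 4 by lia.
  rewrite 2 (exp_partial_S _ (S (S (2 * n)))), 2 (exp_partial_S _ (S (2 * n))).
  replace (S (S (2 * n))) with (2 * S n)%nat by lia.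
  rewrite Hodd, Heven.
  field; repeat split; try apply INR_fact_C_neq_0.
Qed.

(** The bound depends on the radius [B] alone, so it is uniform along any curve inside that disc. *)
Lemma Ccosh_remainder (z : C) (n : nat) (B : R) : Cmod z <= B ->
  Cmod (Ccosh z - cosh_partial z n)
  <= exp B * (B ^ (2 * S n) / INR (fact (2 * S n))).
Proof.
intros HB.
assert (Hz := Cmod_ge_0 z).
assert (Hray : forall w, Cmod w = Cmod z ->
  Cmod (Cexp w - exp_partial w (S (2 * n)))
  <= exp B * (B ^ (2 * S n) / INR (fact (2 * S n)))).
{ intros w Hw.
  assert (H := Cexp_ray_remainder w (S (2 * n)) 1 ltac:(lra)).
  rewrite Cmult_1_l, pow1, Hw in H.
  replace (S (S (2 * n))) with (2 * S n)%nat in H by lia.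
  eapply Rle_trans; [ exact H | ].
  unfold Rdiv; rewrite Rmult_1_l, Rmult_assoc.
  apply Rmult_le_compat.
  - apply Rlt_le, exp_pos.
  - apply Rmult_le_pos; [ now apply pow_le | ].
    apply Rlt_le, Rinv_0_lt_compat, INR_fact_lt_0.
  - destruct HB as [HB | HB]; [ left; now apply exp_increasing | right; now rewrite HB ].
  - apply Rmult_le_compat_r.
    + apply Rlt_le, Rinv_0_lt_compat, INR_fact_lt_0.
    + now apply pow_incr. }
assert (H1 := Hray z eq_refl).
assert (H2 := Hray (- z)%C (Cmod_opp z)).
rewrite cosh_partial_exp; unfold Ccosh.
replace (_ - _)%C with (RtoC (/ 2) * ((Cexp z - exp_partial z (S (2 * n)))
  + (Cexp (- z) - exp_partial (- z) (S (2 * n)))))%C.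
2: { rewrite RtoC_inv by lra; field; intros H; apply RtoC_inj in H; lra. }
rewrite Cmod_mult, Cmod_R, Rabs_pos_eq by lra.
assert (H3 := Cmod_triangle (Cexp z - exp_partial z (S (2 * n)))
  (Cexp (- z) - exp_partial (- z) (S (2 * n)))).
lra.
Qed.

Lemma is_lim_seq_pow_fact (B : R) :
  is_lim_seq (fun n => B ^ n / INR (fact n)) 0.
Proof.
apply ex_series_lim_0; exists (exp B).
eapply is_series_ext; [ | apply is_exp_Reals ].
intros n; simpl; now rewrite pow_n_pow.
Qed.

(** * Recurrence for the integrals of even powers *)

Lemma RtoC_neq_0 (x : R) : x <> 0 -> RtoC x <> 0.
Proof. intros Hx H; apply Hx; now apply RtoC_inj. Qed.

Lemma is_CRInt_plus (f g : R -> C) (a b : R) (lf lg : C) :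
  is_CRInt f a b lf -> is_CRInt g a b lg ->
  is_CRInt (fun t => (f t + g t)%C) a b (lf + lg)%C.
Proof. apply (is_RInt_plus (V := C_R_NormedModule)). Qed.

Lemma is_CRInt_ext (f g : R -> C) (a b : R) (l : C) :
  (forall t, f t = g t) -> is_CRInt f a b l -> is_CRInt g a b l.
Proof. intros H; apply (is_RInt_ext (V := C_R_NormedModule)); auto. Qed.

(** The derivative of w^(2n+1) w' is (2n+1) w^(2n) w'^2 - w^(2n+2). Inserting w'^2 = d - w^2 gives
    (2n+1) d w^(2n) - (2n+2) w^(2n+2), which is integrated and solved for the last power. *)
Lemma is_CRInt_even_pow_step (w w' : R -> C) (d : C) (a b : R) (n : nat) (I : C) :
  (forall t, is_Cderive w t (w' t)) ->
  (forall t, is_Cderive w' t (- w t)%C) ->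
  (forall t, (w t ^ 2 + w' t ^ 2)%C = d) ->
  is_CRInt (fun t => (w t ^ (2 * n))%C) a b I ->
  is_CRInt (fun t => (w t ^ (2 * S n))%C) a b
    ((RtoC (INR (2 * n + 1)) * d * I
      - (w b ^ S (2 * n) * w' b - w a ^ S (2 * n) * w' a))
     / RtoC (INR (2 * S n)))%C.
Proof.
intros Hw Hw' Hd HI.
assert (HN : RtoC (INR (2 * S n)) <> 0) by (apply RtoC_neq_0, not_0_INR; lia).
assert (HF : forall t, is_Cderive (fun t => (w t ^ S (2 * n) * w' t)%C) t
  (RtoC (INR (2 * n + 1)) * d * w t ^ (2 * n)
   - RtoC (INR (2 * S n)) * w t ^ (2 * S n))%C).
{ intros t; eapply is_Cderive_eq.
  - apply is_Cderive_mult; [ apply is_Cderive_pow, Hw | apply Hw' ].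
  - rewrite <- (Hd t).
    replace (2 * S n)%nat with (S (S (2 * n))) by lia.
    replace (2 * n + 1)%nat with (S (2 * n)) by lia.
    rewrite (S_INR (S (2 * n))), RtoC_plus, !Cpow_S.
    cbn [Cpow]; ring. }
assert (HcF : forall t, @continuous R_UniformSpace C_R_NormedModule
  (fun t => (RtoC (INR (2 * n + 1)) * d * w t ^ (2 * n)
   - RtoC (INR (2 * S n)) * w t ^ (2 * S n))%C) t).
{ intros t.
  assert (Hp : forall k, exists l, is_Cderive (fun t => (w t ^ k)%C) t l).
  { intros [ | k].
    - exists (RtoC 0); exact (is_Cderive_const 1 t).
    - eexists; exact (is_Cderive_pow w t _ k (Hw t)). }
  destruct (Hp (2 * n)%nat) as [l1 H1]; destruct (Hp (2 * S n)%nat) as [l2 H2].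
  eapply is_Cderive_continuous, is_Cderive_minus.
  - exact (is_Cderive_mult _ _ _ _ _ (is_Cderive_const _ t) H1).
  - exact (is_Cderive_mult _ _ _ _ _ (is_Cderive_const _ t) H2). }
assert (HI' := is_RInt_derive (V := C_R_CompleteNormedModule)
  (fun t => (w t ^ S (2 * n) * w' t)%C) _ a b (fun t _ => HF t)
  (fun t _ => HcF t)).
assert (H := is_CRInt_Cmult (/ RtoC (INR (2 * S n)))%C _ a b _
  (is_CRInt_plus _ _ _ _ _ _
    (is_CRInt_Cmult (RtoC (INR (2 * n + 1)) * d)%C _ _ _ _ HI)
    (is_CRInt_Cmult (- (1))%C _ _ _ _ HI'))).
match type of H with @is_RInt _ ?f _ _ ?l =>
  match goal with |- @is_RInt _ _ _ _ ?l' => replace l' with l end end.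
- revert H; apply is_CRInt_ext; intros t; cbv beta; now field.
- change (@minus C_R_CompleteNormedModule) with Cminus; now field.
Qed.

(** By the end conditions, w^(2n+1) w' takes opposite values for [wp] and [wm] both at a and at b.
    The sum of the integrals is thus multiplied by (2n+1) d / (2n+2) at each step, and these factors
    accumulate to (d/4)^n times the central binomial coefficient. [Ip] and [Im] stay existential
    because each alone still carries boundary terms. *)
Lemma is_CRInt_even_pow_pair (wp wp' wm wm' : R -> C) (d : C) (a b : R) :
  (forall t, is_Cderive wp t (wp' t)) ->
  (forall t, is_Cderive wp' t (- wp t)%C) ->
  (forall t, (wp t ^ 2 + wp' t ^ 2)%C = d) ->
  (forall t, is_Cderive wm t (wm' t)) ->
  (forall t, is_Cderive wm' t (- wm t)%C) ->
  (forall t, (wm t ^ 2 + wm' t ^ 2)%C = d) ->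
  wm a = wp a -> wm' a = (- wp' a)%C ->
  wm b = (- wp b)%C -> wm' b = wp' b ->
  forall n, exists Ip Im,
  is_CRInt (fun t => (wp t ^ (2 * n))%C) a b Ip /\
  is_CRInt (fun t => (wm t ^ (2 * n))%C) a b Im /\
  (Ip + Im)%C = (RtoC (2 * (b - a)) * (d / RtoC 4) ^ n
    * RtoC (INR (fact (2 * n)) / (INR (fact n) * INR (fact n))))%C.
Proof.
intros Hp Hp' Hpd Hm Hm' Hmd Ha Ha' Hb Hb' n.
induction n as [ | n [Ip [Im [HIp [HIm HI]]]]].
- exists (RtoC (b - a)), (RtoC (b - a)).
  assert (H1 : is_CRInt (fun _ => RtoC 1) a b (RtoC (b - a))).
  { replace (RtoC (b - a)) with (@scal R_AbsRing C_R_NormedModule (b - a) (RtoC 1)).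
    - apply (is_RInt_const (V := C_R_NormedModule)).
    - unfold scal; simpl; unfold prod_scal, RtoC, scal; simpl; unfold mult; simpl.
      f_equal; ring. }
  repeat split; try exact H1.
  simpl; rewrite Rmult_1_r, Rdiv_1_r, RtoC_mult; ring.
- do 2 eexists; split; [ | split ].
  + apply (is_CRInt_even_pow_step wp wp' d a b n Ip); auto.
  + apply (is_CRInt_even_pow_step wm wm' d a b n Im); auto.
  + assert (HN : RtoC (INR (2 * S n)) <> 0) by (apply RtoC_neq_0, not_0_INR; lia).
    rewrite Ha, Ha', Hb, Hb'.
    assert (Hodd : ((- wp b) ^ S (2 * n) = - wp b ^ S (2 * n))%C).
    { rewrite !Cpow_S, !Cpow_mult_r.
      replace ((- wp b) ^ 2)%C with (wp b ^ 2)%C by ring; ring. }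
    rewrite Hodd.
    transitivity (RtoC (INR (2 * n + 1)) * d * (Ip + Im) / RtoC (INR (2 * S n)))%C;
      [ now field | ].
    rewrite HI.
    (* The ratio of consecutive central binomial coefficients is (2n+2)(2n+1) / (n+1)^2 = 4 (2n+1) /
       (2n+2); its 4 is absorbed by the new factor d / 4. *)
    replace (INR (fact (2 * S n)) / (INR (fact (S n)) * INR (fact (S n))))
      with (4 * INR (2 * n + 1) / INR (2 * S n)
            * (INR (fact (2 * n)) / (INR (fact n) * INR (fact n)))).
    2: { replace (2 * S n)%nat with (S (S (2 * n))) by lia.
      rewrite (fact_simpl n), (fact_simpl (S (2 * n))), (fact_simpl (2 * n)), !mult_INR.
      replace (2 * n + 1)%nat with (S (2 * n)) by lia.
      replace (INR (S (S (2 * n)))) with (2 * INR (S n))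
        by (rewrite !S_INR, mult_INR; simpl; ring).
      field; split; [ apply INR_fact_neq_0 | now apply not_0_INR ]. }
    rewrite Cpow_S, (RtoC_mult (_ / INR (2 * S n))).
    rewrite (RtoC_div (4 * _)), (RtoC_mult 4) by (apply not_0_INR; lia).
    field; exact HN.
Qed.

(** * From the moments to the partial sums of J0 *)

(** Since (z/2)^(2k) = (- d / 4)^k, the alternating sign of the series cancels. Only the square of z
    enters, so either square root of - d may be used. *)
Lemma J0_term_div_fact_sqr (z d : C) (k : nat) : (z * z = - d)%C ->
  J0_term z k
  = ((d / RtoC 4) ^ k / (RtoC (INR (fact k)) * RtoC (INR (fact k))))%C.
Proof.
intros Hz; unfold J0_term.
replace ((z / 2) ^ (2 * k))%C with (((- d) / RtoC 4) ^ k)%C.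
2: { rewrite Cpow_mult_r, <- Hz; f_equal.
     replace (RtoC 4) with (RtoC 2 * RtoC 2)%C by (rewrite <- RtoC_mult; f_equal; ring).
     field; apply RtoC_neq_0; lra. }
replace (- d / RtoC 4)%C with (- (1) * (d / RtoC 4))%C
  by (field; apply RtoC_neq_0; lra).
rewrite Cpow_mult_l.
assert (H1 : ((- (1)) ^ k * (- (1)) ^ k)%C = RtoC 1).
{ rewrite <- Cpow_mult_l; replace (- (1) * - (1))%C with (RtoC 1) by ring.
  apply Cpow_1_l. }
transitivity (((- (1)) ^ k * (- (1)) ^ k) * ((d / RtoC 4) ^ k
  / (RtoC (INR (fact k)) * RtoC (INR (fact k)))))%C.
- field; repeat split; try apply INR_fact_C_neq_0; apply RtoC_neq_0; lra.
- rewrite H1; ring.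
Qed.

Lemma is_Cderive_trig (al be : C) (t : R) :
  is_Cderive (fun t => (RtoC (cos t) * al + RtoC (sin t) * be)%C) t
    (RtoC (cos t) * be - RtoC (sin t) * al)%C.
Proof.
eapply is_Cderive_eq.
- apply is_Cderive_plus.
  + exact (is_Cderive_mult _ _ _ _ _
      (is_Cderive_RtoC cos t _ (is_derive_cos t)) (is_Cderive_const al t)).
  + exact (is_Cderive_mult _ _ _ _ _
      (is_Cderive_RtoC sin t _ (is_derive_sin t)) (is_Cderive_const be t)).
- rewrite RtoC_opp; ring.
Qed.

(** The factor (2k)! in the moments is the denominator of the cosh polynomial; removing it from the
    central binomial coefficient leaves the 1 / (k!)^2 of J0. *)
Lemma is_CRInt_cosh_partial_pair (w1 w2 : R -> C) (a b : R) (M : nat -> C) :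
  (forall k, exists I1 I2,
    is_CRInt (fun t => (w1 t ^ (2 * k))%C) a b I1 /\
    is_CRInt (fun t => (w2 t ^ (2 * k))%C) a b I2 /\
    (I1 + I2 = RtoC (INR (fact (2 * k))) * M k)%C) ->
  forall n, is_CRInt (fun t => (cosh_partial (w1 t) n + cosh_partial (w2 t) n)%C) a b
    (sum_n (G := C_AbelianMonoid) M n).
Proof.
intros HM.
assert (Hk : forall k, is_CRInt (fun t => (w1 t ^ (2 * k) / RtoC (INR (fact (2 * k)))
   + w2 t ^ (2 * k) / RtoC (INR (fact (2 * k))))%C) a b (M k)).
{ intros k; destruct (HM k) as [I1 [I2 [H1 [H2 H]]]].
  assert (Hf := INR_fact_C_neq_0 (2 * k)).
  replace (M k) with (/ RtoC (INR (fact (2 * k))) * (I1 + I2))%C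
    by (rewrite H; now field).
  apply (is_CRInt_ext (fun t => (/ RtoC (INR (fact (2 * k)))
    * (w1 t ^ (2 * k) + w2 t ^ (2 * k)))%C)); [ intros t; now field | ].
  now apply is_CRInt_Cmult, is_CRInt_plus. }
intros n; induction n as [ | n IH ].
- rewrite sum_O; generalize (Hk 0%nat); apply is_CRInt_ext.
  intros t; unfold cosh_partial; now rewrite !sum_O.
- rewrite sum_Sn; assert (H := is_CRInt_plus _ _ _ _ _ _ IH (Hk (S n))).
  revert H; apply is_CRInt_ext; intros t; unfold cosh_partial.
  rewrite !sum_Sn; change (@plus C_AbelianMonoid) with Cplus; ring.
Qed.

Lemma Cmod_J0_remainder (z : C) (e : R) : 0 < e ->
  exists N, forall n, (N <= n)%nat ->
  Cmod (sum_n (G := C_AbelianMonoid) (J0_term z) n - J0 z) < e.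
Proof.
intros He.
assert (H := J0_is_series z).
assert (H' := proj1 (filterlim_locally_ball_norm (K := C_AbsRing)
  (U := C_NormedModule) _ _) H (mkposreal e He)).
exact H'.
Qed.

(** * The integral over [0, PI/2] *)

Lemma Cexp_plus (x y : C) : Cexp (x + y) = (Cexp x * Cexp y)%C.
Proof.
unfold Cexp, Cmult, Re, Im; simpl.
rewrite exp_plus, cos_plus, sin_plus; f_equal; ring.
Qed.

(** As cos y = cosh (i y), this is the product-to-sum formula for cosh. It merges the two factors of
    the integrand into cosh at single points. *)
Lemma cos_mult_Ccosh (y : R) (z : C) :
  (RtoC (cos y) * Ccosh z)%C
  = (/ RtoC 2 * (Ccosh (z + Ci * RtoC y) + Ccosh (z - Ci * RtoC y)))%C.
Proof.
assert (Hi : forall s, Cexp (Ci * RtoC s) = (RtoC (cos s) + Ci * RtoC (sin s))%C).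
{ intros s; unfold Cexp, Ci, RtoC, Cmult, Cplus, Re, Im; simpl.
  replace (0 * s - 1 * 0) with 0 by ring.
  replace (0 * 0 + 1 * s) with s by ring.
  rewrite exp_0; f_equal; ring. }
assert (Hi' : forall s, Cexp (- (Ci * RtoC s)) = (RtoC (cos s) - Ci * RtoC (sin s))%C).
{ intros s; replace (- (Ci * RtoC s))%C with (Ci * RtoC (- s))%C
    by (rewrite RtoC_opp; ring).
  rewrite Hi, cos_neg, sin_neg, RtoC_opp; ring. }
unfold Ccosh.
replace (- (z + Ci * RtoC y))%C with (- z + - (Ci * RtoC y))%C by ring.
replace (- (z - Ci * RtoC y))%C with (- z + Ci * RtoC y)%C by ring.
unfold Cminus; rewrite !Cexp_plus, Hi, Hi'.
field; apply RtoC_neq_0; lra.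
Qed.

(** The Jacobian u cos t of x = u sin t has cancelled the singular factor 1 / sqrt (u^2 - x^2). *)
Definition trig_integrand (a : R) (c : C) (t : R) : C :=
  (RtoC (cos (a * sin t)) * Ccosh (c * RtoC (cos t)))%C.

(** The solution of w'' = - w with w(0) = c and w'(0) = i a. Changing the sign of [a] amounts to
    reversing t, which yields the second curve of the pair. *)
Definition rotating (c : C) (a t : R) : C :=
  (RtoC (cos t) * c + RtoC (sin t) * (Ci * RtoC a))%C.

Lemma trig_integrand_rotating (a : R) (c : C) (t : R) :
  trig_integrand a c t
  = (/ RtoC 2 * (Ccosh (rotating c a t) + Ccosh (rotating c (- a) t)))%C.
Proof.
unfold trig_integrand, rotating; rewrite cos_mult_Ccosh.
rewrite RtoC_mult, RtoC_opp; do 3 f_equal; ring.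
Qed.

Lemma ex_Cderive_Ccosh (f : R -> C) (t : R) (l : C) :
  is_Cderive f t l -> exists l', is_Cderive (fun t => Ccosh (f t)) t l'.
Proof.
intros Hf; eexists; unfold Ccosh, Cdiv.
apply is_Cderive_mult; [ | apply is_Cderive_const ].
apply is_Cderive_plus; apply is_Cderive_Cexp; [ exact Hf | ].
exact (is_derive_opp (V := C_R_NormedModule) _ _ _ Hf).
Qed.

Lemma continuous_trig_integrand (a : R) (c : C) (t : R) :
  @continuous R_UniformSpace C_R_NormedModule (trig_integrand a c) t.
Proof.
destruct (ex_Cderive_Ccosh (rotating c a) t _ (is_Cderive_trig _ _ t)) as [l1 H1].
destruct (ex_Cderive_Ccosh (rotating c (- a)) t _ (is_Cderive_trig _ _ t)) as [l2 H2].
apply (continuous_ext (U := C_R_NormedModule) _ _ t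
  (fun t => eq_sym (trig_integrand_rotating a c t))).
eapply is_Cderive_continuous.
apply is_Cderive_mult; [ apply is_Cderive_const | now apply is_Cderive_plus; eauto ].
Qed.

(** Supplies one disc for the whole curve, as uniformity of the cosh remainder requires. *)
Lemma Cmod_rotating_le (c : C) (a t : R) :
  Cmod (rotating c a t) <= Cmod c + Rabs a.
Proof.
unfold rotating; eapply Rle_trans; [ apply Cmod_triangle | ].
rewrite !Cmod_mult, !Cmod_R.
replace (Cmod Ci) with 1
  by (unfold Cmod, Ci; simpl; replace (_ + _) with 1 by ring; now rewrite sqrt_1).
assert (Hc := Rabs_le _ _ (COS_bound t)); assert (Hs := Rabs_le _ _ (SIN_bound t)).
assert (H1 := Cmod_ge_0 c); assert (H2 := Rabs_pos a); rewrite Rmult_1_l.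
assert (Hle : forall x y, x <= 1 -> 0 <= y -> x * y <= y) by (intros; nra).
now apply Rplus_le_compat; apply Hle.
Qed.

Lemma is_CRInt_cosh_partial_rotating (a : R) (c z : C) (n : nat) :
  (z * z = RtoC a * RtoC a - c * c)%C ->
  is_CRInt (fun t => (/ RtoC 2 * (cosh_partial (rotating c a t) n
      + cosh_partial (rotating c (- a) t) n))%C) 0 (PI / 2)
    (RtoC (PI / 2) * sum_n (G := C_AbelianMonoid) (J0_term z) n)%C.
Proof.
intros Hz.
(* The invariant is c^2 + (i a')^2, which sees only the square of a'; stating it for every a' with
   that square covers both curves. *)
assert (Hd : forall a' t, (a' * a' = a * a)%R ->
  (rotating c a' t ^ 2 + (RtoC (cos t) * (Ci * RtoC a') - RtoC (sin t) * c) ^ 2)%C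
  = (- (z * z))%C).
{ intros a' t Ha'; rewrite Hz, <- RtoC_mult, <- Ha', RtoC_mult; unfold rotating.
  assert (Hsc : (RtoC (cos t) * RtoC (cos t))%C
    = (RtoC 1 - RtoC (sin t) * RtoC (sin t))%C).
  { rewrite <- !RtoC_mult, <- RtoC_minus; f_equal.
    assert (H := sin2_cos2 t); unfold Rsqr in H; lra. }
  assert (Hi : (Ci * Ci = - (1))%C).
  { unfold Ci, Cmult, Copp, RtoC; simpl; f_equal; ring. }
  transitivity ((RtoC (cos t) * RtoC (cos t) + RtoC (sin t) * RtoC (sin t))
    * (c * c + Ci * Ci * (RtoC a' * RtoC a')))%C; [ ring | ].
  rewrite Hsc, Hi; ring. }
(* The pair of curves carries the weight 2 (PI / 2) = PI, which the average then halves. *)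
replace (RtoC (PI / 2) * sum_n (G := C_AbelianMonoid) (J0_term z) n)%C
  with (/ RtoC 2 * sum_n (G := C_AbelianMonoid)
  (fun k => RtoC PI * J0_term z k)%C n)%C.
2: { replace (sum_n (G := C_AbelianMonoid) (fun k => RtoC PI * J0_term z k)%C n)
      with (RtoC PI * sum_n (G := C_AbelianMonoid) (J0_term z) n)%C.
     - rewrite RtoC_div by lra; field; apply RtoC_neq_0; lra.
     - symmetry; exact (sum_n_mult_l (K := C_Ring) _ _ n). }
apply is_CRInt_Cmult, is_CRInt_cosh_partial_pair; intros k.
destruct (is_CRInt_even_pow_pair
  (rotating c a)
  (fun t => RtoC (cos t) * (Ci * RtoC a) - RtoC (sin t) * c)%C
  (rotating c (- a))
  (fun t => RtoC (cos t) * (Ci * RtoC (- a)) - RtoC (sin t) * c)%C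
  (- (z * z))%C 0 (PI / 2)) with (n := k) as [I1 [I2 [H1 [H2 HI]]]].
- intros t; apply is_Cderive_trig.
- intros t; eapply is_Cderive_eq.
  + apply (is_derive_ext (K := R_AbsRing) (V := C_R_NormedModule)
      (fun t => (RtoC (cos t) * (Ci * RtoC a) + RtoC (sin t) * - c)%C)
      (fun t => (RtoC (cos t) * (Ci * RtoC a) - RtoC (sin t) * c)%C)).
    * intros s; apply (f_equal (Cplus _)); ring.
    * apply is_Cderive_trig.
  + unfold rotating; ring.
- intros t; now apply Hd.
- intros t; apply is_Cderive_trig.
- intros t; eapply is_Cderive_eq.
  + apply (is_derive_ext (K := R_AbsRing) (V := C_R_NormedModule)
      (fun t => (RtoC (cos t) * (Ci * RtoC (- a)) + RtoC (sin t) * - c)%C)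
      (fun t => (RtoC (cos t) * (Ci * RtoC (- a)) - RtoC (sin t) * c)%C)).
    * intros s; apply (f_equal (Cplus _)); ring.
    * apply is_Cderive_trig.
  + unfold rotating; ring.
- intros t; apply Hd; ring.
- unfold rotating; rewrite sin_0; ring.
- cbv beta; rewrite sin_0, RtoC_opp; ring.
- unfold rotating; rewrite cos_PI2, RtoC_opp; ring.
- cbv beta; rewrite cos_PI2; ring.
- exists I1, I2; repeat split; try assumption.
  rewrite HI, (J0_term_div_fact_sqr z (- (z * z))) by ring.
  replace (2 * (PI / 2 - 0)) with PI by field.
  rewrite RtoC_div, RtoC_mult
    by (apply Rmult_integral_contrapositive; split; apply INR_fact_neq_0).
  field; apply INR_fact_C_neq_0.
Qed.

(** PI / 2 times the n-th partial sum of J0 is close to the integral by the uniform cosh remainder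
    and close to the claimed value by convergence of the series. *)
Lemma is_CRInt_trig_integrand (a : R) (c z : C) :
  (z * z = RtoC a * RtoC a - c * c)%C ->
  is_CRInt (trig_integrand a c) 0 (PI / 2) (RtoC (PI / 2) * J0 z)%C.
Proof.
intros Hz.
assert (HPI := PI_RGT_0).
set (S n := sum_n (G := C_AbelianMonoid) (J0_term z) n).
set (P n t := (/ RtoC 2 * (cosh_partial (rotating c a t) n
  + cosh_partial (rotating c (- a) t) n))%C).
assert (Hpart : forall n, is_CRInt (P n) 0 (PI / 2) (RtoC (PI / 2) * S n)%C).
{ intros n; now apply is_CRInt_cosh_partial_rotating. }
(* Continuity gives the existence of the integral [L]; the approximation only has to identify its
   value. *)
destruct (ex_RInt_continuous (V := C_R_CompleteNormedModule)
  (trig_integrand a c) 0 (PI / 2)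
  (fun t _ => continuous_trig_integrand a c t)) as [L HL].
set (B := Cmod c + Rabs a).
assert (Hdist : forall n, Cmod (L - RtoC (PI / 2) * S n)
  <= (PI / 2) * (exp B * (B ^ (2 * Datatypes.S n) / INR (fact (2 * Datatypes.S n))))).
{ intros n; rewrite <- norm_Cmod.
  match goal with |- _ <= PI / 2 * ?M =>
    replace (PI / 2 * M) with ((PI / 2 - 0) * M) by ring end.
  apply (norm_RInt_le_const (V := C_R_NormedModule)
    (fun t => (trig_integrand a c t - P n t)%C)); [ lra | | ].
  - intros t _; rewrite norm_Cmod, trig_integrand_rotating; unfold P.
    assert (H1 := Ccosh_remainder (rotating c a t) n B (Cmod_rotating_le c a t)).
    assert (H2 := Ccosh_remainder (rotating c (- a) t) n B
      ltac:(unfold B; rewrite <- (Rabs_Ropp a); apply Cmod_rotating_le)).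
    assert (H3 := Cmod_triangle (Ccosh (rotating c a t) - cosh_partial (rotating c a t) n)
      (Ccosh (rotating c (- a) t) - cosh_partial (rotating c (- a) t) n)).
    rewrite <- RtoC_inv by lra.
    match goal with |- Cmod ?e <= _ => replace e with (RtoC (/ 2) *
      ((Ccosh (rotating c a t) - cosh_partial (rotating c a t) n)
      + (Ccosh (rotating c (- a) t) - cosh_partial (rotating c (- a) t) n)))%C by ring end.
    rewrite Cmod_mult, Cmod_R, Rabs_pos_eq by lra; lra.
  - exact (is_RInt_minus (V := C_R_NormedModule) _ _ _ _ _ _ HL (Hpart n)). }
replace (RtoC (PI / 2) * J0 z)%C with L; [ exact HL | ].
destruct (Req_dec (Cmod (L - RtoC (PI / 2) * J0 z)) 0) as [H0 | H0].
{ apply Cmod_eq_0 in H0.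
  replace (L : C) with (L - RtoC (PI / 2) * J0 z + RtoC (PI / 2) * J0 z)%C by ring.
  rewrite H0; apply Cplus_0_l. }
exfalso.
set (e := Cmod (L - RtoC (PI / 2) * J0 z)) in *.
assert (He0 : 0 < e).
{ assert (H := Cmod_ge_0 (L - RtoC (PI / 2) * J0 z)); fold e in H; lra. }
(* Both errors get multiplied by PI / 2, so this tolerance makes each less than e / 4 and their sum
   less than e. The further division by [exp B] below offsets that factor of the remainder. *)
assert (He : 0 < e / 2 / PI) by (apply Rdiv_lt_0_compat; lra).
destruct (Cmod_J0_remainder z _ He) as [N1 HN1].
assert (HBe : 0 < e / 2 / PI / exp B) by (apply Rdiv_lt_0_compat; [ lra | apply exp_pos ]).
destruct (proj2 (is_lim_seq_spec _ _) (is_lim_seq_pow_fact B) (mkposreal _ HBe))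
  as [N2 HN2]; simpl in HN2.
set (n := (N1 + N2)%nat).
specialize (HN1 n ltac:(unfold n; lia)).
specialize (HN2 (2 * Datatypes.S n)%nat ltac:(unfold n; lia)).
rewrite Rminus_0_r in HN2; apply Rabs_def2 in HN2; destruct HN2 as [HN2 _].
specialize (Hdist n).
set (r := B ^ (2 * Datatypes.S n) / INR (fact (2 * Datatypes.S n))) in *.
assert (Hr : exp B * r < e / 2 / PI).
{ replace (e / 2 / PI) with (exp B * (e / 2 / PI / exp B)).
  - apply Rmult_lt_compat_l; [ apply exp_pos | exact HN2 ].
  - field; split; [ lra | apply Rgt_not_eq, exp_pos ]. }
assert (Htri := Cmod_triangle (L - RtoC (PI / 2) * S n)
  (RtoC (PI / 2) * (S n - J0 z))).
replace (L - RtoC (PI / 2) * S n + RtoC (PI / 2) * (S n - J0 z))%C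
  with (L - RtoC (PI / 2) * J0 z)%C in Htri by ring.
fold e in Htri.
rewrite Cmod_mult, Cmod_R, (Rabs_pos_eq (PI / 2)) in Htri by lra.
change (Cmod (S n - J0 z) < e / 2 / PI) in HN1.
assert (HP : PI / 2 * (e / 2 / PI) = e / 4) by (field; lra).
assert (PI / 2 * (exp B * r) < PI / 2 * (e / 2 / PI))
  by (apply Rmult_lt_compat_l; lra).
assert (PI / 2 * Cmod (S n - J0 z) < PI / 2 * (e / 2 / PI))
  by (apply Rmult_lt_compat_l; lra).
lra.
Qed.

(** * The substitution x = u sin t and the limit at u *)

(** The derivative of asin blows up at 1, so monotonicity of sin is used: asin (b / u) <= PI / 2 - e
    would force b / u <= sin (PI / 2 - e), which fails for b close to u. *)
Lemma filterlim_asin_div_at_left (u : R) : 0 < u ->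
  filterlim (fun b => asin (b / u)) (at_left u) (locally (PI / 2)).
Proof.
intros hu; apply filterlim_locally; intros eps.
assert (He := cond_pos eps); assert (HPI := PI2_1).
(* Since 1 < PI / 2, the cap keeps PI / 2 - e positive, where sin is nonnegative and increasing up
   to PI / 2. *)
set (e := Rmin eps 1).
assert (He1 : 0 < e <= 1).
{ unfold e; split; [ apply Rmin_pos; lra | apply Rmin_r ]. }
assert (He2 : e <= eps) by apply Rmin_l.
assert (Hs : sin (PI / 2 - e) < 1).
{ rewrite <- sin_PI2; apply sin_increasing_1; lra. }
assert (Hs0 : 0 <= sin (PI / 2 - e)) by (apply sin_ge_0; lra).
assert (Hd : 0 < u * (1 - sin (PI / 2 - e))) by (apply Rmult_lt_0_compat; lra).
exists (mkposreal _ Hd); intros b Hb Hbu.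
assert (Hb' : Rabs (b - u) < u * (1 - sin (PI / 2 - e))) by exact Hb.
apply Rabs_def2 in Hb'.
assert (Hlo : sin (PI / 2 - e) < b / u) by (apply Rlt_div_r; lra).
assert (Hhi : b / u < 1) by (apply Rlt_div_l; lra).
assert (Hasin := asin_bound (b / u)).
change (Rabs (asin (b / u) - PI / 2) < eps).
apply Rabs_def1; [ lra | ].
destruct (Rle_lt_dec (asin (b / u)) (PI / 2 - e)) as [Hle | Hlt]; [ | lra ].
exfalso.
assert (Hsin : sin (asin (b / u)) <= sin (PI / 2 - e)) by (apply sin_incr_1; lra).
rewrite sin_asin in Hsin by lra; lra.
Qed.

Lemma is_derive_asin_div (u x : R) : 0 < u -> Rabs x < u ->
  is_derive (fun x => asin (x / u)) x (/ sqrt (u ^ 2 - x ^ 2)).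
Proof.
intros hu Hx; apply Rabs_def2 in Hx.
assert (Hr : -1 < x / u < 1).
{ split; [ apply Rlt_div_r | apply Rlt_div_l ]; lra. }
replace (/ sqrt (u ^ 2 - x ^ 2)) with (/ u * (1 / sqrt (1 - Rsqr (x / u)))).
- apply (is_derive_comp (V := R_NormedModule) asin (fun x => x / u)).
  + apply is_derive_Reals; rewrite <- (derive_pt_asin (x / u) Hr).
    apply derive_pt_eq_1 with (derivable_pt_asin (x / u) Hr); reflexivity.
  + auto_derive; [ trivial | field; lra ].
- replace (u ^ 2 - x ^ 2) with (Rsqr u * (1 - Rsqr (x / u)))
    by (unfold Rsqr; field; lra).
  rewrite sqrt_mult_alt, sqrt_Rsqr by (try apply Rle_0_sqr; lra).
  field; split; [ | lra ].
  apply Rgt_not_eq, sqrt_lt_R0; unfold Rsqr; nra.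
Qed.

Lemma cos_asin_div (u x : R) : 0 < u -> Rabs x < u ->
  u * cos (asin (x / u)) = sqrt (u ^ 2 - x ^ 2).
Proof.
intros hu Hx; apply Rabs_def2 in Hx.
assert (Hr : -1 < x / u < 1).
{ split; [ apply Rlt_div_r | apply Rlt_div_l ]; lra. }
rewrite cos_asin by lra.
replace (u ^ 2 - x ^ 2) with (Rsqr u * (1 - Rsqr (x / u)))
  by (unfold Rsqr; field; lra).
now rewrite sqrt_mult_alt, sqrt_Rsqr by (try apply Rle_0_sqr; lra).
Qed.

(** For a primitive [Psi] of f, the function Psi (asin (x / u)) is a primitive of g on [0, b]
    whenever b < u, although not differentiably controlled at u itself. The improper integral is
    then the limit of its values as b tends to u, found from the continuity of [Psi]. *)
Lemma is_CRInt_gen_asin_subst (f : R -> C) (g : R -> C) (u : R) (l : C) :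
  0 < u ->
  (forall t, @continuous R_UniformSpace C_R_NormedModule f t) ->
  is_CRInt f 0 (PI / 2) l ->
  (forall x, Rabs x < u -> g x = (RtoC (/ sqrt (u ^ 2 - x ^ 2)) * f (asin (x / u)))%C) ->
  @is_RInt_gen C_R_NormedModule g (at_point 0) (at_left u) l.
Proof.
intros hu Hf Hl Hg.
set (Psi := RInt (V := C_R_CompleteNormedModule) f 0).
assert (HPsi : forall t, is_CRInt f 0 t (Psi t)).
{ intros t; apply (RInt_correct (V := C_R_CompleteNormedModule)).
  apply (ex_RInt_continuous (V := C_R_CompleteNormedModule)); auto. }
assert (HdPsi : forall t, is_Cderive Psi t (f t)).
{ intros t; apply (is_derive_RInt (V := C_R_NormedModule) f Psi 0); [ | apply Hf ].
  now apply filter_forall. }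
replace l with (Psi (PI / 2)).
2: { apply (is_RInt_unique (V := C_R_CompleteNormedModule)); exact Hl. }
unfold is_RInt_gen.
apply (filterlimi_lim_ext_loc (fun ab => Psi (asin (snd ab / u)))).
- exists (fun a => a = 0) (fun b => 0 < b < u); [ reflexivity | | ].
  { exists (mkposreal u hu); intros b Hb Hbu.
    assert (Hb' : Rabs (b - u) < u) by exact Hb.
    apply Rabs_def2 in Hb'; lra. }
  intros a b -> Hb; simpl fst; simpl snd.
  (* The same integrand written with the real scalar action, the form in which the chain rule
     produces it. *)
  set (g0 := fun x => @scal R_AbsRing C_R_NormedModule (/ sqrt (u ^ 2 - x ^ 2))
    (f (asin (x / u)))).
  apply (is_RInt_ext (V := C_R_NormedModule) g0).
  { intros x Hx; rewrite Rmin_left, Rmax_right in Hx by lra.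
    rewrite Hg by (apply Rabs_def1; lra); unfold g0.
    destruct (f (asin (x / u))) as [r i].
    unfold scal, Cmult; simpl; unfold prod_scal, scal; simpl; unfold mult; simpl.
    apply (f_equal2 pair); ring. }
  (* The lower end contributes nothing: asin 0 = 0 and [Psi] starts at 0. *)
  replace (Psi (asin (b / u))) with
    (@minus C_R_NormedModule (Psi (asin (b / u))) (Psi (asin (0 / u)))).
  2: { unfold Rdiv at 2; rewrite Rmult_0_l, asin_0; unfold Psi.
       rewrite (RInt_point (V := C_R_CompleteNormedModule)).
       apply (minus_zero_r (G := C_R_NormedModule)). }
  apply (is_RInt_derive (V := C_R_CompleteNormedModule)
    (fun x => Psi (asin (x / u))) g0);
    intros x Hx; rewrite Rmin_left, Rmax_right in Hx by lra;
    assert (Hxu : Rabs x < u) by (apply Rabs_def1; lra).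
  + apply (is_derive_comp (V := C_R_NormedModule) Psi (fun x => asin (x / u)));
      [ apply HdPsi | now apply is_derive_asin_div ].
  + apply (continuous_scal (V := C_R_NormedModule)
      (fun x => / sqrt (u ^ 2 - x ^ 2)) (fun x => f (asin (x / u)))).
    * apply (ex_derive_continuous (V := R_NormedModule)).
      assert (Hp : 0 < u ^ 2 - x ^ 2) by (apply Rabs_def2 in Hxu; nra).
      auto_derive; repeat split; [ simpl in *; lra | ].
      apply Rgt_not_eq, sqrt_lt_R0; simpl in *; lra.
    * apply (continuous_comp (fun x => asin (x / u)) f); [ | apply Hf ].
      apply (ex_derive_continuous (V := R_NormedModule)).
      eexists; now apply is_derive_asin_div.
- apply (filterlim_comp _ _ _ snd (fun b => Psi (asin (b / u))) _ (at_left u));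
    [ apply filterlim_snd | ].
  apply (filterlim_comp _ _ _ (fun b => asin (b / u)) Psi _ (locally (PI / 2))).
  + now apply filterlim_asin_div_at_left.
  + exact (is_Cderive_continuous Psi (PI / 2) _ (HdPsi _)).
Qed.

Theorem mainTheorem15 (p u : R) (q : C) (hp : 0 < p) (hu : 0 < u) :
  @is_RInt_gen C_R_NormedModule
    (fun x : R =>
       (RtoC (cos (p * x)) * Ccosh (q * RtoC (sqrt (u ^ 2 - x ^ 2)))
          / RtoC (sqrt (u ^ 2 - x ^ 2)))%C)
    (at_point 0) (at_left u)
    (RtoC (PI / 2) * J0 (Csqrt (RtoC p ^ 2 - q ^ 2) * RtoC u))%C.
Proof.
apply (is_CRInt_gen_asin_subst (trig_integrand (p * u) (q * RtoC u))); [ exact hu | | | ].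
- apply continuous_trig_integrand.
- apply is_CRInt_trig_integrand.
  (* With a = p u and c = q u, the required square a^2 - c^2 is u^2 (p^2 - q^2); [Csqrt] enters only
     through its square. *)
  transitivity (Csqrt (RtoC p ^ 2 - q ^ 2) * Csqrt (RtoC p ^ 2 - q ^ 2)
    * (RtoC u * RtoC u))%C; [ ring | ].
  rewrite Csqrt_sqr, RtoC_mult; ring.
- intros x Hx; unfold trig_integrand.
  assert (Hp : 0 < u ^ 2 - x ^ 2) by (apply Rabs_def2 in Hx; nra).
  assert (Hs := sqrt_lt_R0 _ Hp).
  rewrite <- (Cmult_assoc q), <- RtoC_mult, cos_asin_div by assumption.
  rewrite sin_asin.
  + replace (p * u * (x / u)) with (p * x) by (field; lra).
    rewrite RtoC_inv by lra; unfold Cdiv; ring.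
  + apply Rabs_def2 in Hx.
    split; [ apply Rle_div_r | apply Rle_div_l ]; lra.
Qed.
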